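(* Let $k$ be an algebraically closed field, let $n\ge 2$, let $d\in\mathbb{Z}$, and let $g_0,\dots,g_n$ be Laurent monomials in $x_0,\dots,x_n$, all of degree $d$, such that $\phi:(x_0:\dots:x_n)\mapsto(g_0:\dots:g_n)$ defines a Cremona transformation $\mathbb{P}^n_k\dashrightarrow\mathbb{P}^n_k$. Let $A$ be the $d$-stochastic $(n+1)\times(n+1)$ log-matrix of $(g_0,\dots,g_n)$. Then the inverse map $\phi^{-1}$ is also monomial and, assuming $d\ne 0$ (in which case $A$ is invertible over $\mathbb{Q}$), the degree of $\phi^{-1}$ is $$d^{-1}-\sum_{i} r_i,$$ where the sum is over all $n+1$ row indices $i$ and $r_i$ denotes the least value occurring in the $i$-th row of $A^{-1}$.
   Context: A Laurent monomial is a product $x_0^{a_0}\cdots x_n^{a_n}$ with $a_i\in\mathbb{Z}$ (coefficient $1$); its degree is $\sum a_i$. The log-matrix of $(g_0,\dots,g_n)$ is the integer matrix whose $j$-th column lists the exponents of $x_0,\dots,x_n$ in $g_j$. A matrix is $d$-stochastic if each of its columns has sum $d$. A Cremona transformation is a birational map $\mathbb{P}^n_k\dashrightarrow\mathbb{P}^n_k$; it is monomial if it can be given by $(x_0:\dots:x_n)\mapsto(h_0:\dots:h_n)$ with the $h_i$ monomials of the same degree. The degree of a Cremona transformation is the common degree of the homogeneous polynomials defining it once all common nonconstant factors have been canceled. (In particular the degree of $\phi$ itself need not equal the integer $d$ above, since the $g_j$ may be Laurent monomials or have common factors.) *)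

(* Defs.v *)
From HB Require Import structures.
From mathcomp Require Import all_boot all_order all_algebra.
From mathcomp Require Import mpoly.

Set Implicit Arguments.
Unset Strict Implicit.
Unset Printing Implicit Defensive.

Import Order.TTheory GRing.Theory Num.Theory.
Local Open Scope ring_scope.

(* A representative of a rational map P^n_k --> P^n_k: homogeneous coordinates *)
(* of the common degree rm_deg, not all zero. Distinct tuples, possibly of     *)
(* distinct degrees, may give the same map: see same_map.                      *)
Record ratmap (k : fieldType) (n : nat) := RatMap {
  rm_coord :> n.+1.-tuple {mpoly k[n.+1]};
  rm_deg : nat;
  rm_homog : forall i, tnth rm_coord i \is rm_deg.-homog;
  rm_neq0 : exists i, tnth rm_coord i != 0
}.

Definition same_map (k : fieldType) (n : nat) (F G : ratmap k n) : Prop :=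
  forall i j, tnth F i * tnth G j = tnth F j * tnth G i.

(* G o F is defined (its coordinates G_i(F_0, ..., F_n) do not all vanish) and *)
(* is the identity of P^n.                                                     *)
Definition left_inverse (k : fieldType) (n : nat) (G F : ratmap k n) : Prop :=
  (exists i, tnth G i \mPo F != 0) /\
  forall i j, (tnth G i \mPo F) * 'X_j = (tnth G j \mPo F) * 'X_i.

Definition inverse_map (k : fieldType) (n : nat) (F G : ratmap k n) : Prop :=
  left_inverse G F /\ left_inverse F G.

Definition cremona (k : fieldType) (n : nat) (F : ratmap k n) : Prop :=
  exists G : ratmap k n, inverse_map F G.

Definition monomial_map (k : fieldType) (n : nat) (F : ratmap k n) : Prop :=
  exists (e : nat) (m : 'I_n.+1 -> 'X_{1..n.+1}),
    (forall i, mdeg (m i) = e) /\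
    forall i j, tnth F i * 'X_[m j] = tnth F j * 'X_[m i].

Definition no_common_factor (k : fieldType) (n : nat) (F : ratmap k n) : Prop :=
  forall p : {mpoly k[n.+1]},
    (forall i, exists q, tnth F i = p * q) -> exists c : k, p = c%:MP.

(* e is the degree of the homogeneous coordinates of the map F once all common *)
(* nonconstant factors have been cancelled.                                    *)
Definition has_degree (k : fieldType) (n : nat) (F : ratmap k n) (e : nat) : Prop :=
  exists H : ratmap k n, [/\ same_map F H, no_common_factor H & rm_deg H = e].

Definition laurent_monomial (k : fieldType) (n : nat) (a : 'I_n.+1 -> int) :
    {fraction {mpoly k[n.+1]}} :=
  \prod_(i < n.+1) (tofrac ('X_i : {mpoly k[n.+1]})) ^ a i.

Definition log_matrix (k : fieldType) (n : nat)
    (g : 'I_n.+1 -> {fraction {mpoly k[n.+1]}}) (A : 'M[int]_n.+1) : Prop :=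
  forall j, g j = laurent_monomial k (fun i => A i j).

Definition stochastic (n : nat) (d : int) (A : 'M[int]_n) : Prop :=
  forall j, \sum_i A i j = d.

(* F represents the map (x_0 : ... : x_n) |-> (g_0 : ... : g_n). *)
Definition given_by (k : fieldType) (n : nat) (F : ratmap k n)
    (g : 'I_n.+1 -> {fraction {mpoly k[n.+1]}}) : Prop :=
  forall i j, tofrac (tnth F i) * g j = tofrac (tnth F j) * g i.

Definition row_min (n : nat) (B : 'M[rat]_n.+1) (i : 'I_n.+1) : rat :=
  \big[Num.min/B i ord0]_(j < n.+1) B i j.

(* Main.v *)
Require Import Defs.
From HB Require Import structures.
From mathcomp Require Import all_boot all_order all_algebra.
From mathcomp Require Import mpoly.
From mathcomp Require Import zify.

Set Implicit Arguments.
Unset Strict Implicit.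
Unset Printing Implicit Defensive.

Import Order.TTheory GRing.Theory Num.Theory.
Local Open Scope ring_scope.

(* Write x, G for the coordinates and for psi, and a_j for the columns of A.  *)
(* After clearing denominators and common factors, phi is given by monomials,  *)
(* so comparing supports in G_i(phi) x_j = G_j(phi) x_i yields degree-0        *)
(* integer vectors v_i with A v_i = e_i - e_0. The other composition says that *)
(* G^(a_j) is proportional to x_j, hence G^(A v) = x^v for every v of degree   *)
(* 0, and v = v_i gives G_i / G_0 = x^(v_i): psi is monomial. Its degree is    *)
(* obtained by shifting the v_i to nonnegative vectors that attain 0 in every  *)
(* coordinate, i.e. by subtracting the vector c of minima. If d <> 0, then     *)
(* v_i is the difference of the columns i and 0 of A^-1, whose columns sum to  *)
(* d^-1; so the degree - sum c equals d^-1 minus the sum of the row minima.    *)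

Definition monz (F : fieldType) (I : finType) (x : I -> F) (a : I -> int) : F :=
  \prod_i x i ^ a i.

Lemma eq_monz (F : fieldType) (I : finType) (x : I -> F) (a b : I -> int) :
  a =1 b -> monz x a = monz x b.
Proof. by move=> eq_ab; apply: eq_bigr => i _; rewrite eq_ab. Qed.

Lemma monz_neq0 (F : fieldType) (I : finType) (x : I -> F) (a : I -> int) :
  (forall i, x i != 0) -> monz x a != 0.
Proof. by move=> x_neq0; apply/prodf_neq0 => i _; rewrite expfz_neq0. Qed.

Lemma monzD (F : fieldType) (I : finType) (x : I -> F) (a b : I -> int) :
  (forall i, x i != 0) -> monz x (fun i => a i + b i) = monz x a * monz x b.
Proof.
move=> x_neq0; rewrite /monz -big_split; apply: eq_bigr => i _ /=.
by rewrite expfzDr.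
Qed.

Lemma monzN (F : fieldType) (I : finType) (x : I -> F) (a : I -> int) :
  monz x (fun i => - a i) = (monz x a)^-1.
Proof. by rewrite /monz -prodfV; apply: eq_bigr => i _; rewrite invr_expz. Qed.

Lemma monz1 (F : fieldType) (I : finType) (x : I -> F) (i : I) :
  monz x (fun l => (l == i)%:Z) = x i.
Proof.
by rewrite /monz (bigD1 i) //= eqxx big1 ?mulr1 // => l /negPf ->.
Qed.

Lemma monz_comp (F : fieldType) (I J : finType) (x : I -> F)
    (a : J -> I -> int) (v : J -> int) :
    (forall i, x i != 0) ->
  monz (fun j => monz x (a j)) v = monz x (fun i => \sum_j a j i * v j).
Proof.
move=> x_neq0; rewrite /monz.
under eq_bigr => j _.
  rewrite (big_morph (fun y => y ^ v j) (fun y z => expfzMl y z (v j))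
    (exp1rz _ (v j))).
  over.
rewrite exchange_big /=; apply: eq_bigr => i _.
rewrite (big_morph (fun c => x i ^ c) (fun c d => expfzDr _ _ (x_neq0 i))
  (expr0z (x i))).
by apply: eq_bigr => j _; rewrite exprz_exp.
Qed.

Lemma tofracX (R : idomainType) (n : nat) (m : 'X_{1..n}) :
  tofrac ('X_[m] : {mpoly R[n]}) =
  monz (fun i => tofrac ('X_i : {mpoly R[n]})) (fun i => (m i)%:Z).
Proof.
rewrite mpolyXE_id rmorph_prod; apply: eq_bigr => i _.
by rewrite rmorphXn exprnP.
Qed.

(** * Divisibility and monomials without a common factor *)

(* The condition that every coordinate vanishes for some j says that the         *)
(* monomials 'X_[m j] have no common factor.                                     *)
Lemma tight_shift (n : nat) (v : 'I_n.+1 -> 'I_n.+1 -> int) :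
  exists (c : 'I_n.+1 -> int) (m : 'I_n.+1 -> 'X_{1..n.+1}),
    (forall j l, (m j l)%:Z = v j l - c l) /\
    (forall l, exists j, m j l = 0%N).
Proof.
have min_v l : {i | forall j, v i l <= v j l}.
  exists [arg min_(i < ord0) v i l]%O => j.
  by case: arg_minP => // i _ /(_ j isT).
pose c l := v (sval (min_v l)) l.
have mE j l : ([multinom `|v j l - c l|%N | l < n.+1] l)%:Z = v j l - c l.
  by rewrite mnmE gez0_abs // subr_ge0 /c; case: (min_v l) => /= i; apply.
exists c, (fun j => [multinom `|v j l - c l|%N | l < n.+1]); split=> // l.
by exists (sval (min_v l)); rewrite mnmE /c subrr.
Qed.

Lemma monomial_dvd (R : idomainType) (n : nat) (p : {mpoly R[n]}) (a : 'X_{1..n}) :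
  (forall b, b \in msupp p -> (a <= b)%MM) -> exists q, p = q * 'X_[a].
Proof.
move=> le_ab; exists (\sum_(b <- msupp p) p@_b *: 'X_[b - a]).
rewrite {1}[p]mpolyE mulr_suml !big_seq; apply: eq_bigr => b /le_ab le_b.
by rewrite -scalerAl -mpolyXD submK.
Qed.

(** For [b] in the support of [f i], the proportion puts [m j + b] in [m i] plus the support of
    [f j]; a [j] with [m j l = 0] then gives [m i l <= b l]. So ['X_[m i]] divides [f i], and
    cancelling monomials shows that the quotients agree. *)
Lemma proportional_factor (R : idomainType) (n : nat) (I : finType) (i0 : I)
    (f : I -> {mpoly R[n]}) (m : I -> 'X_{1..n}) :
    (forall l, exists j, m j l = 0%N) ->
    (forall i j, f i * 'X_[m j] = f j * 'X_[m i]) ->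
  exists q, forall i, f i = q * 'X_[m i].
Proof.
move=> tight prop_f.
have dvd_f i : exists q, f i = q * 'X_[m i].
  apply: monomial_dvd => b b_f; apply/mnm_lepP => l.
  have [j mjl] := tight l.
  have: (m j + b)%MM \in msupp (f j * 'X_[m i]).
    by rewrite -prop_f (perm_mem (msuppMX _ _)) map_f.
  rewrite (perm_mem (msuppMX _ _)) => /mapP[b' _ /mnmP/(_ l)].
  by rewrite !mnmDE mjl add0n => ->; rewrite leq_addr.
have X_neq0 a : ('X_[a] : {mpoly R[n]}) != 0 by rewrite -msupp_eq0 msuppX.
have [q0 f0E] := dvd_f i0; exists q0 => i.
have [q fE] := dvd_f i; rewrite fE; congr (_ * _).
by have := prop_f i i0; rewrite fE f0E mulrAC => /(mulIf (X_neq0 _))/(mulIf (X_neq0 _)).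
Qed.

(* p as a polynomial in 'X_l, with 'X_l also kept in the coefficients so that the *)
(* coefficients of p can be read off (var_expand_coef).                           *)
Definition var_expand (R : idomainType) (n : nat) (l : 'I_n) (p : {mpoly R[n]}) :
    {poly {mpoly R[n]}} :=
  mmap (polyC \o @mpolyC n R) (fun i => ('X_i)%:P * 'X^(i == l)) p.

Lemma var_expandM (R : idomainType) (n : nat) (l : 'I_n) (p q : {mpoly R[n]}) :
  var_expand l (p * q) = var_expand l p * var_expand l q.
Proof. exact: rmorphM. Qed.

Lemma var_expandX (R : idomainType) (n : nat) (l : 'I_n) (m : 'X_{1..n}) :
  var_expand l ('X_[m] : {mpoly R[n]}) = ('X_[m])%:P * 'X^(m l).
Proof.
rewrite /var_expand mmapX /mmap1.
under eq_bigr => i _ do rewrite exprMn -exprM -polyC_exp.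
rewrite big_split /= -rmorph_prod -mpolyXE_id; congr (_ * _).
rewrite (bigD1 l) //= eqxx mul1n big1 ?mulr1 // => i /negPf ->.
by rewrite mul0n expr0.
Qed.

Lemma var_expand_coef (R : idomainType) (n : nat) (l : 'I_n) (p : {mpoly R[n]})
    (m : 'X_{1..n}) : ((var_expand l p)`_(m l))@_m = p@_m.
Proof.
rewrite [p in var_expand _ p]mpolyE /var_expand raddf_sum /= coef_sum raddf_sum /=.
rewrite [RHS](congr1 (mcoeff m) (mpolyE p)) raddf_sum /=; apply: eq_bigr => b _.
rewrite mmapZ /= -/(var_expand l _) var_expandX mulrA -polyCM coefCM coefXn.
rewrite mul_mpolyC -!scalerAl !mcoeffZ mulr_natr mcoeffMn mcoeffX.
by case: (eqVneq b m) => [->|_]; rewrite ?eqxx ?mulr1n // mul0rn.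
Qed.

(** Over a domain the degree in one variable is additive, so [p] has degree 0 in ['X_l] once it
    divides a monomial free of ['X_l]. *)
Lemma dvd_coprime_monomials (R : idomainType) (n : nat) (I : finType)
    (m : I -> 'X_{1..n}) (p : {mpoly R[n]}) :
    (forall l, exists j, m j l = 0%N) ->
    (forall i, exists q, 'X_[m i] = p * q) -> exists c, p = c%:MP.
Proof.
(* Additivity of degrees in terms of sizes: [true] is the size of a nonzero constant, [t] and [s]
   are the sizes of the two factors, and [c] is an exponent occurring in the first. *)
have arith (s t c : nat) : (0 < s)%N -> (c < t)%N -> true = (t + s).-1 :> nat -> c = 0%N.
  by lia.
move=> tight dvd_p; exists p@_0; apply/mpolyP => b; rewrite mcoeffC.
case: eqVneq => [->|b_neq0]; first by rewrite mulr1.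
rewrite mulr0; apply/eqP; apply: contraNT b_neq0 => pb_neq0.
apply/eqP/mnmP => l; rewrite mnm0E.
have [j mjl] := tight l; have [q pqE] := dvd_p j.
have Xj_neq0 : ('X_[m j] : {mpoly R[n]}) != 0 by rewrite -msupp_eq0 msuppX.
have := congr1 (var_expand l) pqE.
rewrite var_expandM var_expandX mjl expr0 mulr1 => /(congr1 (fun r => size (polyseq r))).
have pq_neq0 : var_expand l p * var_expand l q != 0.
  by rewrite -var_expandM -pqE var_expandX mjl expr0 mulr1 polyC_eq0.
have := pq_neq0; rewrite mulf_eq0 negb_or => /andP[p_neq0 q_neq0].
rewrite size_polyC Xj_neq0 (size_mul p_neq0 q_neq0).
have ltb: (b l < size (var_expand l p))%N.
  rewrite ltnNge; apply: contra pb_neq0 => le_size.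
  by rewrite -(var_expand_coef l) nth_default ?mcoeff0.
rewrite -size_poly_gt0 in q_neq0; exact: arith q_neq0 ltb.
Qed.

(** * Composition with monomials *)

Lemma comp_mpoly_scale (R : comNzRingType) (n k d : nat) (p : {mpoly R[n]})
    (f g : n.-tuple {mpoly R[k]}) (h : {mpoly R[k]}) :
    p \is d.-homog -> (forall i, tnth f i = h * tnth g i) ->
  p \mPo f = h ^+ d * (p \mPo g).
Proof.
move=> /dhomogP p_homog fE; rewrite !comp_mpolyE mulr_sumr big_seq [RHS]big_seq.
apply: eq_bigr => m /p_homog mdeg_m; rewrite -scalerAr; congr (_ *: _).
under eq_bigr => i _ do rewrite fE exprMn.
by rewrite big_split /= prodrXr -mdegE mdeg_m.
Qed.

(** Only this direction holds: distinct terms of [p] may go to the same monomial and cancel. *)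
Lemma msupp_comp_monomials (R : comNzRingType) (n k : nat) (p : {mpoly R[n]})
    (m : 'I_n -> 'X_{1..k}) (u : 'X_{1..k}) :
    u \in msupp (p \mPo [tuple 'X_[m i] | i < n]) ->
  exists2 b, b \in msupp p & forall l, u l = (\sum_i m i l * b i)%N.
Proof.
rewrite comp_mpolyE => /msupp_sum_le/flattenP[_ /mapP[b b_p ->]] /msuppZ_le.
under eq_bigr => i _ do rewrite tnth_mktuple.
rewrite mprodXnE msuppX inE => /eqP ->.
exists b => [|l]; first by move: b_p; rewrite mem_filter.
by rewrite mnm_sumE; apply: eq_bigr => i _; rewrite mulmnE.
Qed.

(** An exponent [u] on the left comes from some [b] in [p]; the proportion matches it with [u'] on
    the right, coming from some [b'] in [q], where [u' - u = e_j - e_i]. Take [v = b' - b], of sum 0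
    because [p] and [q] have the same degree. *)
Lemma monomial_inverse_exponent (R : idomainType) (n d : nat)
    (m : 'I_n -> 'X_{1..n}) (p q : {mpoly R[n]}) (i j : 'I_n) :
    p \is d.-homog -> q \is d.-homog ->
    p \mPo [tuple 'X_[m s] | s < n] != 0 ->
    (p \mPo [tuple 'X_[m s] | s < n]) * 'X_j =
      (q \mPo [tuple 'X_[m s] | s < n]) * 'X_i ->
  exists v : 'I_n -> int, \sum_s v s = 0 /\
    forall l, \sum_s (m s l)%:Z * v s = (l == j)%:Z - (l == i)%:Z.
Proof.
move=> /dhomogP p_homog /dhomogP q_homog.
set pM := p \mPo _; set qM := q \mPo _ => pM_neq0 pqE.
have u_pM := mlead_supp pM_neq0; set u := mlead pM in u_pM.
have: (U_(j) + u)%MM \in msupp (qM * 'X_i).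
  by rewrite -pqE (perm_mem (msuppMX _ _)) map_f.
rewrite (perm_mem (msuppMX _ _)) => /mapP[u' u'_qM /mnmP uE].
have [b b_p bE] := msupp_comp_monomials u_pM.
have [b' b'_q b'E] := msupp_comp_monomials u'_qM.
exists (fun s => (b' s)%:Z - (b s)%:Z); split=> [|l].
  rewrite sumrB -!(big_morph Posz PoszD (erefl 0%:Z)).
  by rewrite -!mdegE (p_homog _ b_p) (q_homog _ b'_q) subrr.
under eq_bigr => s _ do rewrite mulrBr -!PoszM.
rewrite sumrB -!(big_morph Posz PoszD (erefl 0%:Z)) -bE -b'E.
have := uE l; rewrite !mnmDE !mnm1E [j == l]eq_sym [i == l]eq_sym.
by case: (l == j) (l == i) => [] [] /=; lia.
Qed.

(** * Exponents of the inverse map *)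

Lemma left_inverse_comp_neq0 (k : fieldType) (n : nat) (G F : ratmap k n) :
  Defs.left_inverse G F -> forall i, tnth G i \mPo F != 0.
Proof.
move=> [[j Gj_neq0] GF] i; apply: contra_neq Gj_neq0 => Gi0.
have := GF j i; rewrite Gi0 mul0r => /eqP; rewrite mulf_eq0.
by rewrite -[X in _ || X]msupp_eq0 msuppX orbF => /eqP.
Qed.

Lemma tofracX_neq0 (R : idomainType) (n : nat) (i : 'I_n) :
  tofrac ('X_i : {mpoly R[n]}) != 0.
Proof. by rewrite tofrac_eq0 -msupp_eq0 msuppX. Qed.

(** The Laurent monomial of exponent [c], common to the whole family, cancels; identities of
    fractions thus become identities of polynomials. *)
Lemma proportional_shift (R : idomainType) (n : nat) (I : Type)
    (v : I -> 'I_n -> int) (c : 'I_n -> int) (m : I -> 'X_{1..n})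
    (f g : {mpoly R[n]}) (i j : I) :
    (forall j l, (m j l)%:Z = v j l - c l) ->
  (tofrac f * monz (fun l => tofrac ('X_l : {mpoly R[n]})) (v j) =
    tofrac g * monz (fun l => tofrac ('X_l : {mpoly R[n]})) (v i)) <->
  f * 'X_[m j] = g * 'X_[m i].
Proof.
move=> mE; set x := fun l => _.
have x_neq0 l : x l != 0 by apply: tofracX_neq0.
have vE s : monz x (v s) = tofrac 'X_[m s] * monz x c.
  by rewrite tofracX -monzD //; apply: eq_monz => l; rewrite mE subrK.
rewrite !vE !mulrA -!rmorphM; split=> [|-> //].
by move/(mulIf (monz_neq0 _ x_neq0))/eqP; rewrite tofrac_eq => /eqP.
Qed.

Lemma monomial_lattice_surjective (k : fieldType) (n : nat) (A : 'M[int]_n.+1)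
    (phi psi : ratmap k n) :
    given_by phi (fun j => laurent_monomial k (fun i => A i j)) ->
    Defs.left_inverse psi phi ->
  exists v : 'I_n.+1 -> 'I_n.+1 -> int, forall i,
    \sum_s v i s = 0 /\
    forall l, \sum_s A l s * v i s = (l == i)%:Z - (l == ord0)%:Z.
Proof.
move=> phiE psi_phi.
have [c [m [mE m_tight]]] := tight_shift (fun j i => A i j).
have phi_prop i j : tnth phi i * 'X_[m j] = tnth phi j * 'X_[m i].
  exact: (proportional_shift _ _ i j mE).1 (phiE i j).
have [h hE] := proportional_factor ord0 m_tight phi_prop.
pose M := [tuple 'X_[m s] : {mpoly k[n.+1]} | s < n.+1].
have psiE i : tnth psi i \mPo phi = h ^+ rm_deg psi * (tnth psi i \mPo M).
  by apply: comp_mpoly_scale (rm_homog psi i) _ => s; rewrite tnth_mktuple.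
have /fin_all_exists [v vE] i : exists v : 'I_n.+1 -> int,
    \sum_s v s = 0 /\
    forall l, \sum_s (m s l)%:Z * v s = (l == i)%:Z - (l == ord0)%:Z.
  have := left_inverse_comp_neq0 psi_phi ord0.
  rewrite psiE mulf_eq0 negb_or => /andP[hD_neq0 psi0_neq0].
  apply: (monomial_inverse_exponent (rm_homog psi ord0) (rm_homog psi i)) => //.
  have := psi_phi.2 ord0 i; rewrite !psiE -!mulrA.
  exact: mulfI.
exists v => i; have [v0 mv] := vE i; split=> // l.
(* Passing between [m] and [A] costs [c l] times the sum of [v i], which is 0. *)
rewrite -mv; under [RHS]eq_bigr => s _ do rewrite mE mulrBl.
by rewrite sumrB -mulr_sumr v0 mulr0 subr0.
Qed.

Lemma monomial_inverse (k : fieldType) (n : nat) (A : 'M[int]_n.+1)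
    (v : 'I_n.+1 -> 'I_n.+1 -> int) (phi psi : ratmap k n) (i j : 'I_n.+1) :
    given_by phi (fun j => laurent_monomial k (fun i => A i j)) ->
    (forall i, \sum_s v i s = 0 /\
      forall l, \sum_s A l s * v i s = (l == i)%:Z - (l == ord0)%:Z) ->
    inverse_map phi psi ->
  tofrac (tnth psi i) * laurent_monomial k (v j) =
    tofrac (tnth psi j) * laurent_monomial k (v i).
Proof.
move=> phiE vE [psi_phi phi_psi].
have [c [m [mE m_tight]]] := tight_shift (fun j i => A i j).
pose x l := tofrac ('X_l : {mpoly k[n.+1]}).
pose y l := tofrac (tnth psi l).
have x_neq0 l : x l != 0 by apply: tofracX_neq0.
have y_neq0 l : y l != 0.
  rewrite tofrac_eq0; apply: contra_neq (left_inverse_comp_neq0 psi_phi l) => ->.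
  exact: comp_mpoly0.
have ymE s : monz y (fun l => (m s l)%:Z) = tofrac ('X_[m s] \mPo psi).
  rewrite comp_mpolyX rmorph_prod; apply: eq_bigr => l _.
  by rewrite rmorphXn exprnP.
(* The identity [phi] o [psi] = id, once the nonzero composite of coordinate [s] of [phi] with [psi]
   is cancelled. *)
have x_ym s t : x s * monz y (fun l => (m t l)%:Z) = x t * monz y (fun l => (m s l)%:Z).
  rewrite !ymE -!rmorphM; congr tofrac.
  apply: (mulfI (left_inverse_comp_neq0 phi_psi s)).
  have := (proportional_shift _ _ s t mE).1 (phiE s t).
  move/(congr1 (comp_mpoly psi)); rewrite !rmorphM /= => phi_prop.
  by rewrite mulrCA phi_prop mulrCA mulrA (phi_psi.2 t s) -mulrA.
(* The factor between [y^(a_s)] and [x s], with [a_s] the column [s] of [A]; by [x_ym] it is the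
   same for all [s], so it is computed at [ord0]. *)
pose t := monz y (fun l => (m ord0 l)%:Z) * monz y c / x ord0.
have yAE s : monz y (fun l => A l s) = x s * t.
  rewrite (eq_monz _ (b := fun l => (m s l)%:Z + c l)) => [|l].
    rewrite monzD // /t [RHS]mulrA; apply: (canRL (mulfK (x_neq0 _))).
    by rewrite mulrA x_ym mulrAC [_ * x ord0]mulrC.
  by rewrite mE subrK.
have t_neq0 : t != 0.
  by rewrite /t mulf_neq0 ?invr_eq0 // mulf_neq0 // monz_neq0.
have psiE s : y s = monz x (v s) * y ord0.
  have [v0 Av] := vE s.
  have : monz (fun j => monz y (fun l => A l j)) (v s) = y s / y ord0.
    by rewrite monz_comp // (eq_monz _ Av) monzD // monzN !monz1.
  (* The powers of [t] multiply to 1 because [v s] has sum 0. *)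
  have -> : monz (fun j => monz y (fun l => A l j)) (v s) = monz x (v s).
    rewrite /monz; under eq_bigr => l _ do rewrite -/(monz y _) yAE expfzMl.
    rewrite big_split /=.
    rewrite -(big_morph (fun c => t ^ c) (fun c d => expfzDr _ _ t_neq0) (expr0z t)).
    by rewrite v0 expr0z mulr1.
  by move=> ->; rewrite (divfK (y_neq0 ord0)).
rewrite -/(y i) -/(y j) -!/(monz x _) psiE [y j]psiE /laurent_monomial /monz.
by rewrite mulrAC [RHS]mulrAC [X in X * _]mulrC.
Qed.

(** * The inverse matrix and the degree formula *)

(** The initial value [B i ord0] of the iterated minimum is itself an entry of the row, so it does
    not lower the result. *)
Lemma row_minE (n : nat) (B : 'M[rat]_n.+1) (i j : 'I_n.+1) :
  (forall s, B i j <= B i s) -> row_min B i = B i j.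
Proof.
move=> le_Bij; apply/le_anti/andP; split.
  by rewrite /row_min (bigD1 j) //= ge_min lexx.
rewrite /row_min; elim/big_ind: _ => // a b le_a le_b.
by rewrite le_min le_a.
Qed.

Lemma sum_delta_diff (R : pzRingType) (I : finType) (f : I -> R) (i j : I) :
  \sum_l f l * ((l == i)%:Z - (l == j)%:Z)%:~R = f i - f j.
Proof.
have sum_delta s : \sum_l f l * ((l == s)%:Z)%:~R = f s.
  by rewrite (bigD1 s) //= eqxx mulr1 big1 ?addr0 // => l /negPf ->; rewrite mulr0.
by rewrite -!sum_delta -sumrB; apply: eq_bigr => l _; rewrite rmorphB mulrBr.
Qed.

(** If [u A = 0], then [u (e_i - e_0) = u A v_i = 0], so [u] is constant; a column sum then gives
    [d u_0 = 0]. *)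
Lemma stochastic_unitmx (n : nat) (d : int) (A : 'M[int]_n.+1)
    (v : 'I_n.+1 -> 'I_n.+1 -> int) :
    stochastic d A -> d != 0 ->
    (forall i l, \sum_s A l s * v i s = (l == i)%:Z - (l == ord0)%:Z) ->
  (map_mx intr A : 'M[rat]_n.+1) \in unitmx.
Proof.
move=> sumA d_neq0 Av; rewrite unitmxE unitfE; apply/det0P => -[u u_neq0 uA0].
have uAs s : \sum_l u ord0 l * (A l s)%:~R = 0.
  have /matrixP/(_ ord0 s) := uA0; rewrite !mxE => uAs; rewrite -[RHS]uAs.
  by apply: eq_bigr => l _; rewrite !mxE.
have u_const i : u ord0 i = u ord0 ord0.
  have: \sum_s (\sum_l u ord0 l * (A l s)%:~R) * (v i s)%:~R = 0.
    by apply: big1 => s _; rewrite uAs mul0r.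
  under eq_bigr => s _ do rewrite mulr_suml.
  rewrite exchange_big /=.
  under eq_bigr => l _.
    under eq_bigr => s _ do rewrite -mulrA -rmorphM.
    rewrite -mulr_sumr -rmorph_sum Av; over.
  by rewrite sum_delta_diff => /eqP; rewrite subr_eq0 => /eqP.
have := uAs ord0; under eq_bigr => l _ do rewrite u_const.
rewrite -mulr_sumr -rmorph_sum sumA => /eqP.
rewrite mulf_eq0 intr_eq0 (negPf d_neq0) orbF => /eqP u0.
by case/eqP: u_neq0; apply/rowP => i; rewrite u_const u0 mxE.
Qed.

Lemma tight_shift_degree (n : nat) (d : int) (A : 'M[int]_n.+1)
    (v : 'I_n.+1 -> 'I_n.+1 -> int) (c : 'I_n.+1 -> int)
    (m : 'I_n.+1 -> 'X_{1..n.+1}) (i : 'I_n.+1) :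
    stochastic d A -> d != 0 ->
    (forall i, \sum_s v i s = 0 /\
      forall l, \sum_s A l s * v i s = (l == i)%:Z - (l == ord0)%:Z) ->
    (forall j l, (m j l)%:Z = v j l - c l) ->
    (forall l, exists j, m j l = 0%N) ->
  (mdeg (m i))%:R =
    (d%:~R)^-1 - \sum_(l < n.+1) row_min (invmx (map_mx intr A)) l :> rat.
Proof.
move=> sumA d_neq0 vE mE m_tight.
have A_unit := stochastic_unitmx sumA d_neq0 (fun i => (vE i).2).
set AQ := map_mx intr A in A_unit *; set B := invmx AQ.
have dQ_neq0 : d%:~R != 0 :> rat by rewrite intr_eq0.
have Bv j l : B l j = B l ord0 + (v j l)%:~R.
  pose V := \matrix_(l, j) (v j l)%:~R : 'M[rat]_n.+1.
  have /matrixP/(_ l j) : V = B *m (AQ *m V) by rewrite mulKmx.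
  rewrite !mxE => ->; under eq_bigr => s _.
    rewrite mxE; under eq_bigr => t _ do rewrite !mxE -rmorphM.
    rewrite -rmorph_sum (vE j).2; over.
  by rewrite sum_delta_diff addrC subrK.
(* The all-ones row is a left eigenvector of [AQ] for [d], hence of [B] for its inverse. *)
have sumB : \sum_l B l ord0 = (d%:~R)^-1.
  pose e := const_mx 1 : 'rV[rat]_n.+1.
  have eA : e *m AQ = d%:~R *: e.
    apply/rowP => s; rewrite !mxE mulr1 -(sumA s) rmorph_sum.
    by apply: eq_bigr => l _; rewrite !mxE mul1r.
  have /rowP/(_ ord0) : e = d%:~R *: (e *m B).
    by rewrite scalemxAl -eA mulmxK.
  rewrite !mxE => /(canLR (mulKf dQ_neq0)); rewrite mulr1 => ->.
  by apply: eq_bigr => l _; rewrite mxE mul1r.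
(* Where [m j l = 0], the value [v j l = c l] is least among the [v s l], so column [j] attains the
   minimum of row [l]. *)
have rowB l : row_min B l = B l ord0 + (c l)%:~R.
  have [j mjl] := m_tight l.
  have vc : v j l = c l by apply/eqP; rewrite -subr_eq0 -mE mjl.
  rewrite (row_minE (j := j)) => [|s]; first by rewrite (Bv j) vc.
  by rewrite (Bv j) (Bv s) lerD2l ler_int vc -subr_ge0 -mE.
under eq_bigr => l _ do rewrite rowB.
rewrite big_split /= sumB opprD addNKr -rmorph_sum -rmorphN /=.
rewrite pmulrn; congr (_%:~R); rewrite mdegE (big_morph Posz PoszD (erefl 0%:Z)).
by under eq_bigr => l _ do rewrite mE; rewrite sumrB (vE i).1 sub0r.
Qed.

Theorem theorem2 (k : closedFieldType) (n : nat) (hn : (2 <= n)%N) (d : int)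
    (g : 'I_n.+1 -> {fraction {mpoly k[n.+1]}}) (A : 'M[int]_n.+1)
    (hlog : log_matrix g A) (hdeg : stochastic d A)
    (phi : ratmap k n) (hphi : given_by phi g) (hcrem : cremona phi)
    (psi : ratmap k n) (hpsi : inverse_map phi psi) :
  monomial_map psi /\
  (d != 0 ->
   let AQ : 'M[rat]_n.+1 := map_mx intr A in
   AQ \in unitmx /\
   (exists e : nat, has_degree psi e) /\
   forall e : nat, has_degree psi e ->
     e%:R = (d%:~R)^-1 - \sum_(i < n.+1) row_min (invmx AQ) i).
Proof.
have phiE : given_by phi (fun j => laurent_monomial k (fun i => A i j)).
  by move=> i j; rewrite -!hlog.
have [v vE] := monomial_lattice_surjective phiE hpsi.1.
have [c [m [mE m_tight]]] := tight_shift v.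
have psi_prop i j : tnth psi i * 'X_[m j] = tnth psi j * 'X_[m i].
  exact: (proportional_shift _ _ i j mE).1 (monomial_inverse i j phiE vE hpsi).
have psi_neq0 i : tnth psi i != 0.
  apply: contra_neq (left_inverse_comp_neq0 hpsi.1 i) => ->; exact: comp_mpoly0.
(* Both degrees equal minus the sum of [c]. *)
have mdeg_m i : mdeg (m i) = mdeg (m ord0).
  apply/eqP; rewrite -eqz_nat !mdegE !(big_morph Posz PoszD (erefl 0%:Z)).
  under eq_bigr => l _ do rewrite mE; under [X in _ == X]eq_bigr => l _ do rewrite mE.
  by rewrite !sumrB (vE i).1 (vE ord0).1.
split; first by exists (mdeg (m ord0)), m.
move=> d_neq0 AQ; split; first exact: stochastic_unitmx hdeg d_neq0 (fun i => (vE i).2).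
split=> [|e [H [psi_H H_coprime <-]]].
  have H_homog i : tnth [tuple 'X_[m i] : {mpoly k[n.+1]} | i < n.+1] i
      \is (mdeg (m ord0)).-homog.
    by rewrite tnth_mktuple dhomogX; apply/eqP/mdeg_m.
  have H_neq0 : exists i, tnth [tuple 'X_[m i] : {mpoly k[n.+1]} | i < n.+1] i != 0.
    by exists ord0; rewrite tnth_mktuple -msupp_eq0 msuppX.
  exists (mdeg (m ord0)), (RatMap H_homog H_neq0); split=> //.
    by move=> i j; rewrite /= !tnth_mktuple.
  move=> p p_dvd; apply: dvd_coprime_monomials m_tight _ => i.
  by have [q] := p_dvd i; rewrite /= tnth_mktuple; exists q.
(* Proportionality to the monomials passes from [psi] to any reduced representative [H]; the common
   cofactor [q] is then a constant, which fixes the degree of [H]. *)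
have H_prop i j : tnth H i * 'X_[m j] = tnth H j * 'X_[m i].
  apply: (mulfI (psi_neq0 i)).
  by rewrite mulrCA psi_prop mulrCA mulrA -psi_H -mulrA.
have [q HE] := proportional_factor ord0 m_tight H_prop.
have [a qE] := H_coprime q (fun i => ex_intro _ _ (HE i)).
have [i Hi_neq0] := rm_neq0 H.
have -> : rm_deg H = mdeg (m i).
  apply: dhomog_uniq Hi_neq0 (rm_homog H i) _.
  by rewrite HE qE mul_mpolyC dhomogZ // dhomogX.
exact: tight_shift_degree.
Qed.
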